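(* Let $G_1$ and $G_2$ be bipartite graphs with $k_1:=\operatorname{diam}V(G_1)$ and $k_2:=\operatorname{diam}V(G_2)$ such that $k_1\ge k_2\ge 1$. Then $$\max\Big\{\min\Big\{\frac{k_1-1}{2},\,k_2-1\Big\},\,\delta(G_1),\,\delta(G_2)\Big\}\le\delta(G_1\times G_2)\le\frac{k_1}{2}.$$ Furthermore, if $k_1\le 2k_2-2$ and $k_1$ is even, then $\delta(G_1\times G_2)=k_1/2$.
   Context: Conventions. A graph $G$ (such as $G_1,G_2$) is a nonempty, connected, simple (no loops, no multiple edges), possibly infinite graph; every edge has length $1$, and $G$ is regarded as a geodesic metric space by identifying each edge isometrically with $[0,1]$ and using the shortest-path distance $d_G$ (so points of $G$ are vertices and interior points of edges). $\operatorname{diam}V(G):=\sup\{d_G(u,v):u,v\in V(G)\}$. Direct product: $G_1\times G_2$ has vertex set $V(G_1)\times V(G_2)$, and $(u_1,v_1)$, $(u_2,v_2)$ are adjacent iff $[u_1,u_2]\in E(G_1)$ and $[v_1,v_2]\in E(G_2)$. It may be disconnected. Hyperbolicity constant: in a geodesic metric space $X$, a geodesic triangle is the union of three geodesics $[x_1x_2],[x_2x_3],[x_3x_1]$; it is $\delta$-thin if each side is contained in the $\delta$-neighborhood of the union of the other two sides. $\delta(T)$ is the infimum of $\delta\ge 0$ such that $T$ is $\delta$-thin, and $\delta(X):=\sup_T\delta(T)\in[0,\infty]$ over all geodesic triangles $T$ in $X$. If $X$ has connected components $X_i$, then $\delta(X):=\sup_i\delta(X_i)$. *)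

(* Defs.v *)
From mathcomp Require Import all_boot all_order all_algebra.
From mathcomp Require Import all_classical all_reals all_analysis.
Set Implicit Arguments.
Unset Strict Implicit.
Unset Printing Implicit Defensive.
Import Order.TTheory GRing.Theory Num.Theory.
Local Open Scope classical_set_scope.
Local Open Scope ring_scope.

Record sgraph := SGraph {
  vertex :> Type;
  adj : vertex -> vertex -> Prop;
  adj_sym : forall u v, adj u v -> adj v u;
  adj_irrefl : forall u, ~ adj u u
}.

Fixpoint walk (G : sgraph) (n : nat) (u v : G) : Prop :=
  if n is m.+1 then exists w, adj u w /\ walk m w v else u = v.

Definition reachable (G : sgraph) (u v : G) : Prop := exists n, walk n u v.

Definition connected_graph (G : sgraph) : Prop :=
  inhabited G /\ forall u v : G, reachable u v.

Definition bipartite (G : sgraph) : Prop :=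
  exists side : G -> bool, forall u v : G, adj u v -> side u <> side v.

Section DirectProduct.
Variables G1 G2 : sgraph.

Definition dprod_adj (p q : G1 * G2) : Prop := adj p.1 q.1 /\ adj p.2 q.2.

Lemma dprod_adj_sym p q : dprod_adj p q -> dprod_adj q p.
Proof. by move=> [h1 h2]; split; apply: adj_sym. Qed.

Lemma dprod_adj_irrefl p : ~ dprod_adj p p.
Proof. by move=> [h _]; exact: adj_irrefl h. Qed.

Definition dprod : sgraph := SGraph dprod_adj_sym dprod_adj_irrefl.
End DirectProduct.

Section MetricGraph.
Variables (R : realType) (G : sgraph).

(* A point of the geodesic space of G is given by its barycentric coordinates
   [x : G -> R]: the vertex u is the indicator function of u, and the point of
   the edge [u, v] at distance t from u has coordinates 1 - t at u, t at v and
   0 elsewhere.  Each point has a unique such description, so no quotient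
   identifying the two orientations of an edge is needed. *)
Definition at_vertex (x : G -> R) (u : G) : Prop :=
  x u = 1 /\ forall w, w <> u -> x w = 0.

Definition on_edge (x : G -> R) (u v : G) : Prop :=
  [/\ adj u v, 0 <= x u, 0 <= x v, x u + x v = 1 &
      forall w, w <> u -> w <> v -> x w = 0].

Record gpoint := GPoint {
  coord :> G -> R;
  coordP : (exists u, at_vertex coord u) \/ (exists u v, on_edge coord u v)
}.

Definition vcoord (u : G) : G -> R := fun w => (`[< w = u >])%:R.

Lemma vcoordP u :
  (exists v, at_vertex (vcoord u) v) \/ (exists v w, on_edge (vcoord u) v w).
Proof.
left; exists u; split=> [|w wu]; rewrite /vcoord; first by rewrite asboolT.
by rewrite asboolF.
Qed.

Definition vpoint (u : G) : gpoint := GPoint (vcoordP u).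

(* Lengths of the paths from x to y: either a segment inside an edge containing
   both points, or a segment from x to an endpoint u of its edge (of length
   1 - x u), followed by a walk from u to v, followed by a segment from v
   to y. *)
Definition path_length (x y : gpoint) : set R :=
  [set l | (exists u v, [/\ on_edge x u v, on_edge y u v & l = `|x u - y u|])
        \/ (exists u v n, [/\ 0 < x u, 0 < y v, walk n u v &
                              l = (1 - x u) + n%:R + (1 - y v)])].

(* The infimum is +oo exactly when x and y lie in different components. *)
Definition gdist (x y : gpoint) : \bar R :=
  ereal_inf [set l%:E | l in path_length x y].

Definition diamV : \bar R :=
  ereal_sup [set d | exists u v : G, d = gdist (vpoint u) (vpoint v)].

Definition gcomponent (u : G) : set gpoint :=
  [set x : gpoint | forall v, x v <> 0 -> reachable u v].
End MetricGraph.

Section Hyperbolicity.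
Variables (R : realType) (X : Type) (d : X -> X -> \bar R).

Definition geodesic (x y : X) (A : set X) : Prop :=
  exists (l : R) (g : R -> X),
    [/\ 0 <= l, g 0 = x, g l = y,
        forall s t, 0 <= s <= l -> 0 <= t <= l ->
          d (g s) (g t) = `|s - t|%:E
      & A = g @` [set t | 0 <= t <= l]].

Definition neighborhood (e : R) (A : set X) : set X :=
  [set p | exists2 q, A q & (d p q <= e%:E)%E].

Definition thin (A B C : set X) (e : R) : Prop :=
  [/\ A `<=` neighborhood e (B `|` C),
      B `<=` neighborhood e (C `|` A)
    & C `<=` neighborhood e (A `|` B)].

Definition thinness (A B C : set X) : \bar R :=
  ereal_inf [set e%:E | e in [set e : R | 0 <= e /\ thin A B C e]].

Definition geodesic_triangle (A B C : set X) : Prop :=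
  exists x1 x2 x3, [/\ geodesic x1 x2 A, geodesic x2 x3 B & geodesic x3 x1 C].

Definition hyperbolicity (Y : set X) : \bar R :=
  ereal_sup [set e | exists A B C : set X,
    [/\ geodesic_triangle A B C, A `<=` Y, B `<=` Y, C `<=` Y
      & e = thinness A B C]].
End Hyperbolicity.

(* Supremum over the connected components; a connected graph is its own
   unique component. *)
Definition delta (R : realType) (G : sgraph) : \bar R :=
  ereal_sup [set e | exists u : G,
    e = hyperbolicity (@gdist R G) (@gcomponent R G u)].

(* Main.v *)
(* In a bipartite graph without isolated vertices, two vertices are joined by a
   walk of length n exactly when n is at least their distance and has the right
   parity.  Hence the distance between two vertices of a component of G1 x G2 is
   the maximum of the distances of their projections, at most k1; in a bipartite
   graph this bound extends to the points inside the edges.  So the geodesics of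
   G1 x G2 have length at most k1, and a point of a side is at distance at most
   k1 / 2 from an end of that side.

   Each factor is a retract of the product by graph morphisms, through
   u |-> (u, a) or (u, b) according to the side of u, where [a, b] is an edge of
   the other factor; this embeds it isometrically.

   Finally, whenever 2 m <= k1 and m + 1 <= k2, the product of a geodesic of
   length 2 m and one of length m + 1 contains a geodesic bigon one of whose
   midpoints is at distance m from the other side.  Distances are bounded below
   by extending 1-Lipschitz functions on the vertices affinely to the edges. *)
Require Import Defs.
From mathcomp Require Import all_boot all_order all_algebra.
From mathcomp Require Import all_classical all_reals all_analysis.
From mathcomp Require Import zify ring lra.
Import Order.TTheory GRing.Theory Num.Theory.
Local Open Scope classical_set_scope.
Local Open Scope ring_scope.
Set Implicit Arguments.
Unset Strict Implicit.
Unset Printing Implicit Defensive.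

(** * Walks, their parity and the combinatorial distance *)

Section Walks.
Variable G : sgraph.
Implicit Types (u v w : G) (m n : nat).

Lemma walk_cat m n u v w : walk m u v -> walk n v w -> walk (m + n) u w.
Proof.
elim: m u => [|m IH] u /=; first by move=> ->.
by case=> z [uz zv] vw; exists z; split=> //; exact: IH.
Qed.

Lemma walk1 u v : adj u v -> walk 1 u v.
Proof. by move=> uv; exists v. Qed.

Lemma walk_sym n u v : walk n u v -> walk n v u.
Proof.
elim: n u => [|n IH] u /=; first by move=> ->.
case=> z [/adj_sym/walk1 zu /IH vz].
by have := walk_cat vz zu; rewrite addn1.
Qed.

(** Going back and forth along the edge from [u] to [z] adds 2 each time. *)
Lemma walk_pad n k u v z : adj u z -> walk n u v -> walk (n + k.*2) u v.
Proof.
move=> uz uv; elim: k => [|k IH]; first by rewrite double0 addn0.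
rewrite doubleS !addnS; exists z; split=> //; exists u; split=> //.
exact: adj_sym.
Qed.

Lemma walk_parity (side : G -> bool) n u v :
  (forall u v : G, adj u v -> side u <> side v) -> walk n u v ->
  odd n = (side u != side v).
Proof.
move=> sideP; elim: n u => [|n IH] u /=; first by move=> ->; rewrite eqxx.
case=> z [/sideP uz /IH ->].
by case: (side u) (side z) (side v) uz => [] [] [].
Qed.

Lemma connected_adj u v w : connected_graph G -> u <> v -> exists z, adj w z.
Proof.
move=> [_ conn] uv.
have [t wt] : exists t, w <> t.
  by have [wu|] := pselect (w = u); [exists v; rewrite wu|exists u].
by have [[|n]] := conn w t => //= -[z [wz _]]; exists z.
Qed.

(** After reaching [v] the path oscillates on an edge, so adjacency holds at every index without a
    bound to carry along. *)
Lemma walk_path n u v :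
  (forall w, exists z, adj w z) -> walk n u v ->
  exists p : nat -> G, [/\ p 0%N = u, p n = v & forall i, adj (p i) (p i.+1)].
Proof.
move=> nbr; elim: n u => [|n IH] u /=.
  move=> <-; have [z uz] := nbr u.
  exists (fun i => if odd i then z else u); split=> // i /=.
  by case: (odd i) => //=; exact: adj_sym.
case=> z [uz /IH[p [p0 pn pS]]]; exists (fun i => if i is j.+1 then p j else u).
by split=> // -[|i] //=; rewrite p0.
Qed.

Lemma path_walk (p : nat -> G) i k :
  (forall i, adj (p i) (p i.+1)) -> walk k (p i) (p (i + k)%N).
Proof.
move=> pS; elim: k i => [|k IH] i; first by rewrite addn0.
by exists (p i.+1); split=> //; rewrite addnS -addSn.
Qed.

(** The value 0 on unreachable pairs is a default that connected graphs never meet. *)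
Definition vdist u v : nat :=
  if pselect (exists n, `[< walk n u v >]) is left ex then ex_minn ex else 0%N.

Lemma vdist_le n u v : walk n u v -> (vdist u v <= n)%N.
Proof.
move=> uv; rewrite /vdist; case: pselect => // ex.
by case: ex_minnP => m _; apply; apply/asboolP.
Qed.

Lemma walk_vdist u v : reachable u v -> walk (vdist u v) u v.
Proof.
move=> [n uv]; rewrite /vdist; case: pselect => [ex|[]].
  by case: ex_minnP => m /asboolP.
by exists n; apply/asboolP.
Qed.

Lemma vdistxx u : vdist u u = 0%N.
Proof. by apply/eqP; rewrite -leqn0; exact: (@vdist_le 0). Qed.

Hypothesis conn : connected_graph G.

Lemma vdist_trans v u w : (vdist u w <= vdist u v + vdist v w)%N.
Proof. by apply/vdist_le/(@walk_cat _ _ _ v); apply/walk_vdist/conn.2. Qed.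

Lemma vdist_adj o u v : adj u v -> (vdist o u <= (vdist o v).+1)%N.
Proof.
move=> uv; rewrite -addn1; apply: leq_trans (vdist_trans v _ _) _.
by rewrite leq_add2l; apply/vdist_le/walk1/adj_sym.
Qed.

Lemma geodesic_path n u v : (forall w, exists z, adj w z) -> vdist u v = n ->
  exists p : nat -> G, (forall i, adj (p i) (p i.+1)) /\
    (forall i, (i <= n)%N -> vdist (p 0%N) (p i) = i).
Proof.
move=> nbr uvn.
have [p [p0 pn pS]] := walk_path nbr (walk_vdist (conn.2 u v)).
rewrite uvn in pn; exists p; split=> // i ilen; apply/eqP; rewrite eqn_leq.
apply/andP; split; first exact/vdist_le/(path_walk 0 i).
(* A shortcut from [p 0] to [p i] would shorten the whole walk. *)
rewrite -(leq_add2r (n - i)) subnKC// -[leqLHS]uvn -{1}p0 -{1}pn.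
apply: leq_trans (vdist_trans (p i) _ _) _; rewrite leq_add2l.
by apply: vdist_le; rewrite -{2}(subnKC ilen); exact: path_walk.
Qed.

End Walks.

Lemma walk_hom (G1 G2 : sgraph) (h : G1 -> G2) n u v :
  (forall u v, adj u v -> adj (h u) (h v)) -> walk n u v -> walk n (h u) (h v).
Proof.
move=> hadj; elim: n u => [|n IH] u /=; first by move=> ->.
by case=> z [/hadj uz /IH zv]; exists (h z).
Qed.

(** * Points of the metric graph and estimates of their distances *)

Section MetricGraphTheory.
Variables (R : realType) (G : sgraph).
Implicit Types (x y : gpoint R G) (u v w : G) (f : G -> R).

Lemma on_edge_sym (x : G -> R) u v : on_edge x u v -> on_edge x v u.
Proof.
case=> uv xu xv xuv x0; split=> //; first exact: adj_sym.
  by rewrite addrC.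
by move=> w wv wu; apply: x0.
Qed.

Lemma gpoint_ext x y : (forall w, x w = y w) -> x = y.
Proof.
case: x y => [x xP] [y yP] /= /funext xy.
by subst y; congr GPoint; exact: Prop_irrelevance.
Qed.

Lemma vpointxx u : vpoint R u u = 1.
Proof. by rewrite /= /vcoord asboolT. Qed.

Lemma vpoint_neq u w : w <> u -> vpoint R u w = 0.
Proof. by move=> wu; rewrite /= /vcoord asboolF. Qed.

Lemma vpoint_on_edge u v : adj u v -> on_edge (vpoint R u) u v.
Proof.
move=> uv; have vu : v <> u by move=> vu; rewrite vu in uv; exact: adj_irrefl uv.
by split; rewrite ?vpointxx ?(vpoint_neq vu) ?addr0// => w wu _; exact: vpoint_neq.
Qed.

Lemma at_vertexE x u : at_vertex x u -> x = vpoint R u.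
Proof.
move=> [xu x0]; apply: gpoint_ext => w; have [->|wu] := pselect (w = u).
  by rewrite xu vpointxx.
by rewrite x0// vpoint_neq.
Qed.

(** A vertex may also be presented as an end of an edge; the two coordinates there sum to 1, so the
    other one vanishes. *)
Lemma coord1 x u : x u = 1 -> x = vpoint R u.
Proof.
case: (coordP x) => [[v /at_vertexE ->]|[v [w [_ xv xw xvw x0]]]] xu.
  have [->//|uv] := pselect (u = v).
  by move: xu; rewrite vpoint_neq// => /esym/eqP; rewrite oner_eq0.
apply/at_vertexE; split=> // z zu.
have [E|wv] := pselect (u = v); last have [E|ww] := pselect (u = w).
- have xw0 : x w = 0 by move: xvw; rewrite -E xu; lra.
  have [->//|zw] := pselect (z = w); apply: x0 => //; congruence.
- have xv0 : x v = 0 by move: xvw; rewrite -E xu; lra.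
  have [->//|zv] := pselect (z = v); apply: x0 => //; congruence.
- by move: xu; rewrite x0// => /esym/eqP; rewrite oner_eq0.
Qed.

Lemma coord_edge x : (forall w : G, exists z, adj w z) ->
  exists u v, on_edge x u v.
Proof.
move=> nbr; case: (coordP x) => [[u /at_vertexE ->]|//].
by have [v uv] := nbr u; exists u, v; exact: vpoint_on_edge.
Qed.

(* The extension of [f] from the vertices to all points, affine on each edge. *)
Definition bary f (x : G -> R) : R := \sum_(u \in [set: {classic G}]) x u * f u.

Lemma bary_edge f x u v : on_edge x u v -> bary f x = x u * f u + x v * f v.
Proof.
case=> uv _ _ _ x0; have uv' : u <> v by move=> E; rewrite E in uv; exact: adj_irrefl uv.
rewrite /bary -(@fsbig_widen _ _ _ _ ([set u] `|` [set v] : set {classic G}))//.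
  rewrite fsbigU0 ?fsbig_set1//.
  by move=> w [/= -> ].
move=> w [_ /not_orP[/= wu wv]] /=; rewrite x0 ?mul0r//.
Qed.

Lemma bary_vpoint f u : bary f (vpoint R u) = f u.
Proof.
rewrite /bary -(@fsbig_widen _ _ _ _ ([set u] : set {classic G}))//.
  by rewrite fsbig_set1 vpointxx mul1r.
by move=> w [_ /vpoint_neq /= ->]; rewrite mul0r.
Qed.

Definition lipschitz1 f := forall u v, adj u v -> `|f u - f v| <= 1.

Lemma lipschitz1_walk f n u v : lipschitz1 f -> walk n u v -> `|f u - f v| <= n%:R.
Proof.
move=> flip; elim: n u => [|n IH] u /=; first by move=> ->; rewrite subrr normr0.
case=> z [/flip uz /IH zv]; rewrite -[n.+1]add1n natrD.
rewrite (_ : f u - f v = (f u - f z) + (f z - f v)); last by ring.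
by apply: le_trans (ler_normD _ _) _; exact: lerD.
Qed.

Lemma bary_dist f x u : lipschitz1 f -> 0 < x u -> `|bary f x - f u| <= 1 - x u.
Proof.
move=> flip; case: (coordP x) => [[v /at_vertexE ->] xu|[v [w vw]] xu].
  have [<-|uv] := pselect (u = v); last by move: xu; rewrite vpoint_neq ?ltxx.
  by rewrite bary_vpoint vpointxx !subrr normr0.
(* As [x u] is positive, [u] is an end of the edge. *)
wlog uv : v w vw / u = v => [hw|].
  have [E|uv] := pselect (u = v); first exact: hw vw E.
  have [E|uw] := pselect (u = w); first exact: hw (on_edge_sym vw) E.
  by move: xu; case: vw => _ _ _ _ ->; rewrite ?ltxx.
subst v; rewrite (bary_edge f vw); case: vw => /flip uw _ xw xuw _.
rewrite (_ : _ - f u = x w * (f w - f u)); last first.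
  have -> : x u = 1 - x w by lra.
  by ring.
rewrite normrM ger0_norm// distrC; have -> : 1 - x u = x w by lra.
by rewrite ler_piMr.
Qed.

(** The source of all lower bounds on distances: along each piece of a path, [bary f] varies by at
    most the length of that piece. *)
Lemma bary_gdist f x y : lipschitz1 f ->
  (`|bary f x - bary f y|%:E <= gdist x y)%E.
Proof.
move=> flip; apply: le_ereal_inf_tmp => _ [l [] + <-]; rewrite lee_fin.
- move=> [u [v [xuv yuv ->]]]; rewrite !(@bary_edge f _ u v)//.
  case: xuv yuv => /flip uv _ _ xuv _ [_ _ _ yuv _].
  rewrite (_ : _ - _ = (x u - y u) * (f u - f v)).
    by rewrite normrM ler_piMr.
  have -> : x v = 1 - x u by lra.
  have -> : y v = 1 - y u by lra.
  by ring.
- move=> [u [v [n [xu yv uv ->]]]].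
  have h1 := bary_dist flip xu; have h2 := bary_dist flip yv.
  have h3 := lipschitz1_walk flip uv.
  rewrite (_ : _ - _ = (bary f x - f u) + (f u - f v) + (f v - bary f y)); last by ring.
  rewrite distrC in h2; apply: le_trans (ler_normD _ _) _; apply: lerD => //.
  by apply: le_trans (ler_normD _ _) _; exact: lerD.
Qed.

Lemma gdist_ge0 x y : (0 <= gdist x y)%E.
Proof.
apply: le_trans (@bary_gdist (fun=> 0) x y _); first by rewrite lee_fin.
by move=> u v _; rewrite subrr normr0.
Qed.

Lemma gdist_sym x y : gdist x y = gdist y x.
Proof.
suff h (a b : gpoint R G) : (gdist a b <= gdist b a)%E by apply/le_anti; rewrite !h.
apply: le_ereal_inf_tmp => _ [l [] + <-].
- move=> [u [v [bu av ->]]]; apply: ereal_inf_lbound.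
  by exists `|a u - b u|; [left; exists u, v|rewrite distrC].
- move=> [u [v [n [bu av uv ->]]]]; apply: ereal_inf_lbound.
  exists ((1 - a v) + n%:R + (1 - b u)); last by congr EFin; ring.
  by right; exists v, u, n; split=> //; exact: walk_sym.
Qed.

Lemma gdist_edge x y u v : on_edge x u v -> on_edge y u v ->
  (gdist x y <= `|x u - y u|%:E)%E.
Proof.
move=> xuv yuv; apply: ereal_inf_lbound; exists `|x u - y u| => //.
by left; exists u, v.
Qed.

Lemma gdist_pos_walk x y u v n : 0 < x u -> 0 < y v -> walk n u v ->
  (gdist x y <= ((1 - x u) + n%:R + (1 - y v))%:E)%E.
Proof.
move=> xu yv uv; apply: ereal_inf_lbound.
by exists ((1 - x u) + n%:R + (1 - y v)) => //; right; exists u, v, n.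
Qed.

(** [path_length] only admits walks between ends with positive coordinates. If [x a = 0], then [x]
    is the vertex [b], and the term [1 - x a = 1] pays for the step from [b] to [a]; likewise at
    [y]. *)
Lemma gdist_walk x y a b c d n : on_edge x a b -> on_edge y c d -> walk n a c ->
  (gdist x y <= ((1 - x a) + n%:R + (1 - y c))%:E)%E.
Proof.
move=> [ab xa xb xab x0] [cd yc yd ycd y0] ac.
have [xa0|xan] := eqVneq (x a) 0; have [yc0|ycn] := eqVneq (y c) 0.
- have bd : walk (n + 2) b d.
    rewrite addn2 -addn1; apply: walk_cat (walk1 cd).
    by exists a; split=> //; exact: adj_sym.
  apply: le_trans (gdist_pos_walk _ _ bd) _; rewrite ?lee_fin ?natrD; lra.
- have bc : walk n.+1 b c by exists a; split=> //; exact: adj_sym.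
  apply: le_trans (gdist_pos_walk _ _ bc) _; rewrite ?lee_fin ?lt0r ?ycn -?natr1//; lra.
- have ad : walk (n + 1) a d by exact: walk_cat (walk1 cd).
  apply: le_trans (gdist_pos_walk _ _ ad) _; rewrite ?lee_fin ?lt0r ?xan ?natrD//; lra.
- by apply: gdist_pos_walk => //; rewrite lt0r ?xan ?ycn.
Qed.

Lemma edge_point u v (s : R) : adj u v -> 0 <= s <= 1 ->
  exists x, on_edge x u v /\ x v = s.
Proof.
move=> uv /andP[s0 s1].
have uv' : v <> u by move=> E; rewrite E in uv; exact: adj_irrefl uv.
pose c w : R := if pselect (w = u) then 1 - s else if pselect (w = v) then s else 0.
have cu : c u = 1 - s by rewrite /c; case: pselect.
have cv : c v = s by rewrite /c; case: pselect => //; case: pselect.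
have cE : on_edge c u v.
  split=> //; rewrite ?cu ?cv; [lra|lra|lra|].
  by move=> w wu wv; rewrite /c; case: pselect => //; case: pselect.
by have cP : (exists u, at_vertex c u) \/ (exists u v, on_edge c u v);
  [right; exists u, v|exists (GPoint cP)].
Qed.

Lemma path_component (w : nat -> G) i (x : gpoint R G) :
  (forall i, adj (w i) (w i.+1)) -> on_edge x (w i) (w i.+1) ->
  gcomponent (w 0%N) x.
Proof.
move=> wS [_ _ _ _ x0] v xv.
have [->|vi] := pselect (v = w i); first by exists i; exact: (path_walk 0 i).
have [->|vi1] := pselect (v = w i.+1); first by exists i.+1; exact: (path_walk 0 i.+1).
by case: xv; exact: x0.
Qed.

End MetricGraphTheory.

(** * Diameter of the vertex set in terms of walk lengths *)

Section Diameter.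
Variables (R : realType) (G : sgraph).
Hypothesis conn : connected_graph G.
Implicit Types (u v w : G).

Lemma vdist_lipschitz o : lipschitz1 (fun u : G => (vdist o u)%:R : R).
Proof.
move=> u v uv; rewrite ler_distl; have := vdist_adj conn o uv.
have := vdist_adj conn o (adj_sym uv); rewrite -!(ler_nat R) -!natr1; lra.
Qed.

Lemma gdist_vpoint u v : gdist (vpoint R u) (vpoint R v) = (vdist u v)%:R%:E.
Proof.
apply/le_anti/andP; split.
  have uv := walk_vdist (conn.2 u v).
  apply: le_trans (gdist_pos_walk _ _ uv) _; rewrite !vpointxx ?ltr01//.
  by rewrite lee_fin; lra.
apply: le_trans (bary_gdist _ _ (vdist_lipschitz u)).
by rewrite !bary_vpoint vdistxx sub0r normrN ger0_norm.
Qed.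

(** Discrete intermediate values: along a walk from [u] to [v], the distance from [u] starts at 0
    and grows by at most 1 per step. *)
Lemma vdist_onto u v m : (m <= vdist u v)%N -> exists w, vdist u w = m.
Proof.
move=> muv; have [n] := conn.2 u v; have : (vdist u u <= m)%N by rewrite vdistxx.
elim: n {2 3}u => [|n IH] w /= wm; first by move=> wv; exists v; rewrite wv in wm *; lia.
case=> z [wz zv]; have [/IH|mz] := leqP (vdist u z) m; first exact.
by exists w; have := vdist_adj conn u (adj_sym wz); lia.
Qed.

(** A supremum of integers is infinite or attained; [vdist_onto] then realises all smaller
    values. *)
Lemma diamV_cases :
  (diamV R G = +oo%E /\ forall m, exists u v : G, vdist u v = m) \/
  exists D, [/\ diamV R G = D%:R%:E, (forall u v : G, (vdist u v <= D)%N) &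
    forall m, (m <= D)%N -> exists u v : G, vdist u v = m].
Proof.
have vdist_le_diamV u v : ((vdist u v)%:R%:E <= diamV R G)%E.
  by apply: ereal_sup_ubound; exists u, v; rewrite gdist_vpoint.
pose P n := `[< exists u v : G, vdist u v = n >].
have PD D : (forall n, P n -> (n <= D)%N) -> exists D,
    [/\ diamV R G = D%:R%:E, (forall u v : G, (vdist u v <= D)%N) &
    forall m, (m <= D)%N -> exists u v : G, vdist u v = m].
  move=> DP; have exP : exists n, P n.
    by case: conn.1 => u; exists 0%N; apply/asboolP; exists u, u; exact: vdistxx.
  case: (ex_maxnP exP DP) => {DP}D /asboolP[u [v uv]] Dmax; exists D; split.
  - apply/le_anti/andP; split; last by rewrite -uv.
    apply: ge_ereal_sup => _ [a [b ->]].
    rewrite gdist_vpoint lee_fin ler_nat; apply: Dmax.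
    by apply/asboolP; exists a, b.
  - by move=> a b; apply: Dmax; apply/asboolP; exists a, b.
  - by rewrite -uv => m /vdist_onto[w uw]; exists u, w.
have [[D DP]|unb] := pselect (exists D, forall n, P n -> (n <= D)%N).
  by right; exact: PD DP.
left; have big m : exists u v : G, (m < vdist u v)%N.
  apply: contrapT => nm; apply: unb; exists m => n /asboolP[u [v <-]].
  by rewrite leqNgt; apply/negP => mn; apply: nm; exists u, v.
split=> [|m]; last first.
  have [u [v /ltnW/vdist_onto[w uw]]] := big m; by exists u, w.
(* A real diameter [r] would be exceeded by some integer distance above its integer part, and [-oo]
   lies below every distance. *)
apply/eqP; rewrite -leye_eq leNgt; apply/negP => fin.
have [u0 [v0 _]] := big 0%N.
have := vdist_le_diamV; case: (diamV R G) fin => // [r _ h|_ /(_ u0 v0)//].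
have [u [v uv]] := big (Num.truncn r).
have := h u v; rewrite lee_fin leNgt => /negP; apply.
apply: lt_le_trans (truncnS_gt r) _; by rewrite ler_nat.
Qed.
End Diameter.

(** * Construction of geodesics *)

Lemma geodesic_sym (R : realType) (X : Type) (d : X -> X -> \bar R) x y A :
  geodesic d x y A -> geodesic d y x A.
Proof.
move=> [l [g [l0 g0 gl gd ->]]]; exists l, (fun t => g (l - t)); split=> //.
- by rewrite subr0.
- by rewrite subrr.
- move=> s t /andP[s0 sl] /andP[t0 tl]; rewrite gd; last 2 first.
  + by apply/andP; split; lra.
  + by apply/andP; split; lra.
  by congr EFin; rewrite distrC; congr `|_|; ring.
- rewrite eqEsubset; split=> [_ [t /andP[t0 tl] <-]|_ [t /andP[t0 tl] <-]];
    exists (l - t) => /=; rewrite ?subKr//; apply/andP; split; lra.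
Qed.

(** Following the path bounds distances from above; the growth of [f] by 1 per step bounds them from
    below. *)
Lemma polyline_geodesic (R : realType) (G : sgraph) (w : nat -> G) (n : nat)
    (f : G -> R) :
  (forall i, adj (w i) (w i.+1)) -> lipschitz1 f ->
  (forall i, (i <= n)%N -> f (w i) = i%:R) ->
  exists A : set (gpoint R G),
  [/\ geodesic (@gdist R G) (vpoint R (w 0%N)) (vpoint R (w n)) A,
    forall i, (i <= n)%N -> A (vpoint R (w i)) &
    forall x, A x -> exists i, on_edge x (w i) (w i.+1)].
Proof.
move=> wS flip fw.
(* At time [t] the point is on the edge indexed by the integer part of [t], at an offset given by
   the fractional part. *)
have /choice[g gP] : forall t : R, exists x : gpoint R G, 0 <= t ->
    on_edge x (w (Num.truncn t)) (w (Num.truncn t).+1) /\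
    x (w (Num.truncn t).+1) = t - (Num.truncn t)%:R.
  move=> t; have [t0|t0] := leP 0 t; last by exists (vpoint R (w 0%N)).
  have /andP[ti ti1] := truncn_itv t0; rewrite -natr1 in ti1.
  have [|x [xe xt]] := @edge_point R G _ _ (t - (Num.truncn t)%:R) (wS (Num.truncn t)).
    by apply/andP; split; lra.
  by exists x.
have gnat i : g i%:R = vpoint R (w i).
  apply: coord1; have [] := gP i%:R (ler0n _ _).
  by rewrite natrK => -[_ _ _ xx _] xw; rewrite xw in xx; lra.
have gb (t : R) : 0 <= t <= n%:R -> bary f (g t) = t.
  move=> /andP[t0 tn]; have [xe xt] := gP t t0.
  have /andP[ti ti1] := truncn_itv t0; rewrite -natr1 in ti1.
  have [tn'|] := ltnP (Num.truncn t) n.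
    rewrite (bary_edge f xe) !fw ?(ltnW tn')//; case: xe => _ _ _ xx _.
    rewrite xt in xx *.
    have -> : g t (w (Num.truncn t)) = 1 - (t - (Num.truncn t)%:R) by lra.
    by rewrite -natr1; ring.
  (* Only [t = n] remains; [f] is not controlled at [w n.+1], but [g n] is the vertex [w n]. *)
  rewrite -(ler_nat R) => nt; have -> : t = n%:R by lra.
  by rewrite gnat bary_vpoint fw.
have gle (s t : R) : 0 <= s -> s <= t -> (gdist (g s) (g t) <= `|s - t|%:E)%E.
  move=> s0 st; have t0 := le_trans s0 st.
  have [xe xs] := gP s s0; have [ye yt] := gP t t0.
  have : (Num.truncn s <= Num.truncn t)%N by exact: le_truncn.
  rewrite leq_eqVlt => /orP[/eqP ij|ij].
    rewrite -ij in ye yt.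
    apply: le_trans (gdist_edge (on_edge_sym xe) (on_edge_sym ye)) _.
    by rewrite xs yt lee_fin (_ : _ - _ = s - t)//; ring.
  (* From the far end of the edge of [g s] to the near end of that of [g t]; with the two partial
     edges the length is [t - s]. *)
  have wk : walk (Num.truncn t - (Num.truncn s).+1)
      (w (Num.truncn s).+1) (w (Num.truncn t)).
    by rewrite -{2}(subnKC ij); exact: path_walk.
  apply: le_trans (gdist_walk (on_edge_sym xe) ye wk) _.
  rewrite lee_fin xs; case: ye => _ _ _ yy _; rewrite yt in yy.
  rewrite natrB// -natr1 distrC ger0_norm; lra.
exists [set g t | t in [set t | 0 <= t <= n%:R]]; split.
- exists n%:R, g; split=> //; first exact: (gnat 0%N).
  move=> s t sn tn; apply/le_anti/andP; split; last first.
    by rewrite -{1}(gb s)// -{1}(gb t)//; exact: bary_gdist.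
  have [st|ts] := leP s t; first by apply: gle => //; case/andP: sn.
  by rewrite gdist_sym distrC; apply: gle (ltW ts); case/andP: tn.
- by move=> i ilen; exists i%:R; rewrite ?gnat//= ler0n ler_nat.
- move=> _ [t /andP[t0 _] <-]; exists (Num.truncn t); exact: (gP t t0).1.
Qed.

(** * Thinness of triangles of bounded size *)

Section HyperbolicityTheory.
Variables (R : realType) (X : Type) (d : X -> X -> \bar R).
Implicit Types (A B C : set X).

Lemma geodesic_left x y A : geodesic d x y A -> A x.
Proof. by move=> [l [g [l0 <- _ _ ->]]]; exists 0 => //=; rewrite lexx. Qed.

Lemma geodesic_right x y A : geodesic d x y A -> A y.
Proof. by move=> [l [g [l0 _ <- _ ->]]]; exists l => //=; rewrite lexx l0. Qed.

(** Lets a bigon count as a triangle with one degenerate side. *)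
Lemma geodesic_refl x : d x x = 0%E -> geodesic d x x [set x].
Proof.
move=> dxx; exists 0, (fun=> x); split=> //.
  by move=> s t s0 t0; rewrite dxx; congr EFin; rewrite (_ : s - t = 0) ?normr0//; lra.
by rewrite eqEsubset; split=> [_ ->|_ [t _ <-]//]; exists 0 => //=; rewrite lexx.
Qed.

Lemma geodesic_near_ends (D : R) x y A B C : geodesic d x y A -> B y -> C x ->
  (forall l, d x y = l%:E -> l <= D) -> A `<=` neighborhood d (D / 2) (B `|` C).
Proof.
move=> [l [g [l0 <- <- gd ->]]] Bl C0 lD _ [t /= /andP[t0 tl] <-].
have dE s : 0 <= s <= l -> d (g t) (g s) = `|t - s|%:E.
  by move=> sl; apply: gd => //; rewrite t0.
have {}lD : l <= D.
  by apply: lD; rewrite gd ?lexx ?l0 ?lexx// sub0r normrN ger0_norm.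
have [tl2|tl2] := leP t (l / 2).
  exists (g 0); first by right.
  by rewrite dE ?lexx ?l0// subr0 ger0_norm// lee_fin; lra.
exists (g l); first by left.
by rewrite dE ?lexx ?l0// distrC ger0_norm ?subr_ge0// lee_fin; lra.
Qed.

(** Only finite distances are bounded, since distinct components are at distance [+oo]. *)
Lemma hyperbolicity_le (D : R) Y : 0 <= D ->
  (forall x y l, d x y = l%:E -> l <= D) ->
  (hyperbolicity d Y <= (D / 2)%:E)%E.
Proof.
move=> D0 dD; apply: ge_ereal_sup => _ [A [B [C [[x [y [z [gA gB gC]]]] _ _ _ ->]]]].
apply: ereal_inf_lbound; exists (D / 2) => //; split; first by lra.
split.
- by apply: (geodesic_near_ends gA (geodesic_left gB) (geodesic_right gC)); exact: dD.
- by apply: (geodesic_near_ends gB (geodesic_left gC) (geodesic_right gA)); exact: dD.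
- by apply: (geodesic_near_ends gC (geodesic_left gA) (geodesic_right gB)); exact: dD.
Qed.

End HyperbolicityTheory.

(** * Monotonicity of hyperbolicity under isometric embeddings *)

Section Isometry.
Variables (R : realType) (X X' : Type).
Variables (d : X -> X -> \bar R) (d' : X' -> X' -> \bar R) (f : X -> X').
Hypothesis isom : forall x y, d' (f x) (f y) = d x y.

Lemma geodesic_isometry x y A : geodesic d x y A -> geodesic d' (f x) (f y) (f @` A).
Proof.
move=> [l [g [l0 <- <- gd ->]]]; exists l, (f \o g); split=> //.
  by move=> s t sl tl; rewrite isom gd.
by rewrite image_comp.
Qed.

Lemma neighborhood_isometry e (A B C : set X) :
  f @` A `<=` neighborhood d' e (f @` B `|` f @` C) ->
  A `<=` neighborhood d e (B `|` C).
Proof.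
move=> h a Aa; have [|_ [] [b Bb <-]] := h (f a); first by exists a.
  by rewrite isom; exists b => //; left.
by rewrite isom; exists b => //; right.
Qed.

(** Thinness compares points of the three sides only, so a constant valid for the image triangle is
    valid for the original. *)
Lemma hyperbolicity_isometry (Y : set X) (Y' : set X') : f @` Y `<=` Y' ->
  (hyperbolicity d Y <= hyperbolicity d' Y')%E.
Proof.
move=> YY'; apply: ge_ereal_sup => _ [A [B [C [[x [y [z [gA gB gC]]]] AY BY CY ->]]]].
have sub Z : Z `<=` Y -> f @` Z `<=` Y'.
  by move=> ZY; apply: subset_trans YY'; exact: image_subset.
apply: (@le_trans _ _ (thinness d' (f @` A) (f @` B) (f @` C))); last first.
  apply: ereal_sup_ubound; exists (f @` A), (f @` B), (f @` C).
  split=> //; try exact: sub.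
  by exists (f x), (f y), (f z); split; exact: geodesic_isometry.
apply: le_ereal_inf_tmp => _ [e [e0 [hA hB hC]] <-].
apply: ereal_inf_lbound; exists e => //; split=> //.
by split; exact: neighborhood_isometry.
Qed.

End Isometry.

(* A graph is isometrically embedded, with its edges, in a graph of which it is
   a retract. *)
Section Retract.
Variables (R : realType) (G H : sgraph) (i : G -> H) (r : H -> G).
Hypothesis i_adj : forall u v, adj u v -> adj (i u) (i v).
Hypothesis r_adj : forall u v, adj u v -> adj (r u) (r v).
Hypothesis iK : cancel i r.

(** Extension by zero: [p = i (r p)] says that [p] is in the image of [i]. *)
Definition push_coord (x : G -> R) (p : H) : R :=
  if pselect (p = i (r p)) then x (r p) else 0.

Lemma push_coordi x u : push_coord x (i u) = x u.
Proof. by rewrite /push_coord iK; case: pselect. Qed.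

Lemma push_coord_neq0 x p : push_coord x p <> 0 -> p = i (r p).
Proof. by rewrite /push_coord; case: pselect. Qed.

Lemma push_coord0 x p : (forall u, p = i u -> x u = 0) -> push_coord x p = 0.
Proof. by rewrite /push_coord; case: pselect => // pE; apply. Qed.

Lemma push_on_edge x u v : on_edge x u v -> on_edge (push_coord x) (i u) (i v).
Proof.
move=> [uv xu xv xuv x0]; split; rewrite ?push_coordi//; first exact: i_adj.
by move=> p pu pv; apply: push_coord0 => w pE; apply: x0 => E; rewrite -E in pu pv.
Qed.

Lemma push_coordP (x : gpoint R G) :
  (exists u, at_vertex (push_coord x) u) \/ (exists u v, on_edge (push_coord x) u v).
Proof.
case: (coordP x) => [[u [xu x0]]|[u [v xuv]]]; last first.
  by right; exists (i u), (i v); exact: push_on_edge.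
left; exists (i u); split; first by rewrite push_coordi.
by move=> p pu; apply: push_coord0 => w pE; apply: x0 => E; rewrite -E in pu.
Qed.

Definition push (x : gpoint R G) : gpoint R H := GPoint (push_coordP x).

(** When [x] is a vertex, an edge carrying [push x] may have an end outside the image of [i]; [r]
    still folds it onto an edge carrying [x]. *)
Lemma on_edge_push (x : gpoint R G) p q : on_edge (push x) p q ->
  on_edge x (r p) (r q) /\ x (r p) = push x p.
Proof.
move=> xpq.
have pushE a b : on_edge (push x) a b -> x (r a) = push_coord x a.
  move=> [ab _ _ /= xab _].
  (* If [a] is outside the image, the point is the vertex [b], and [r b] differs from [r a] since
     [r] preserves adjacency. *)
  rewrite {1}/push_coord; case: pselect => // na.
  have xa0 : push_coord x a = 0 by rewrite /push_coord; case: pselect.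
  have xb1 : push_coord x b = 1 by rewrite xa0 add0r in xab.
  have bE : b = i (r b) by apply: (@push_coord_neq0 x); rewrite xb1; exact/eqP/oner_neq0.
  have {}xb1 : x (r b) = 1 by rewrite -push_coordi -bE.
  rewrite (coord1 xb1) vpoint_neq// => E.
  by have := r_adj ab; rewrite E; exact: adj_irrefl.
split; last exact: pushE xpq.
have xp := pushE _ _ xpq; have xq := pushE _ _ (on_edge_sym xpq).
case: xpq => /r_adj pq /= p0 q0 pq1 x0; split; rewrite ?xp ?xq//.
by move=> w wp wq; rewrite -push_coordi; apply: x0 => E; rewrite -E iK in wp wq.
Qed.

(** Paths go to [H] by [i] and come back by [r], with unchanged lengths. *)
Lemma gdist_push (x y : gpoint R G) : gdist (push x) (push y) = gdist x y.
Proof.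
apply/le_anti/andP; split; apply: le_ereal_inf_tmp => _ [l [] + <-].
- move=> [u [v [xuv yuv ->]]].
  have := @gdist_edge R H (push x) (push y) _ _ (push_on_edge xuv) (push_on_edge yuv).
  by rewrite /= !push_coordi.
- move=> [u [v [n [xu yv uv ->]]]].
  have := @gdist_pos_walk R H (push x) (push y) (i u) (i v) n.
  rewrite /= !push_coordi; apply=> //; exact: walk_hom uv.
- move=> [u [v [/on_edge_push[xuv <-] /on_edge_push[yuv <-] ->]]].
  exact: gdist_edge xuv yuv.
- move=> [u [v [n [xu yv uv ->]]]].
  have uE : u = i (r u) by apply: (@push_coord_neq0 x) => E; rewrite /= E ltxx in xu.
  have vE : v = i (r v) by apply: (@push_coord_neq0 y) => E; rewrite /= E ltxx in yv.
  move: xu yv; rewrite /= uE vE !push_coordi => xu yv.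
  by apply: gdist_pos_walk => //; exact: walk_hom uv.
Qed.

Lemma delta_retract : (delta R G <= delta R H)%E.
Proof.
apply: ge_ereal_sup => _ [u ->].
apply: (@le_trans _ _ (hyperbolicity (@gdist R H) (gcomponent (i u)))); last first.
  by apply: ereal_sup_ubound; exists (i u).
apply: (hyperbolicity_isometry gdist_push) => _ [x xu <-] p /= xp.
have pE := push_coord_neq0 xp; rewrite pE push_coordi in xp.
have [n un] := xu _ xp; exists n; rewrite pE; exact: walk_hom un.
Qed.

End Retract.

(** * From distances of vertices to distances of points in a bipartite graph *)

Section BipartiteDiameter.
Variables (R : realType) (H : sgraph).
Hypothesis bip : bipartite H.
Hypothesis nbr : forall w : H, exists z, adj w z.

Lemma coord_edge_at (x : gpoint R H) u : 0 < x u -> exists v, on_edge x u v.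
Proof.
move=> xu; have [a [b xab]] := coord_edge x nbr.
have [ua|ua] := pselect (u = a); first by exists b; rewrite ua.
have [ub|ub] := pselect (u = b); first by exists a; rewrite ub; exact: on_edge_sym.
by move: xu; case: xab => _ _ _ _ ->//; rewrite ltxx.
Qed.

(* Of the walks joining the ends of two edges, those of one of the two parities
   have length less than [D]; going through either end, the two lengths obtained
   from such a pair of walks add up to at most [2 * D]. *)
Lemma bipartite_gdist_le (D : nat) (x y : gpoint R H) (l : R) : (0 < D)%N ->
  (forall u v : H, reachable u v -> exists2 n, (n <= D)%N & walk n u v) ->
  gdist x y = l%:E -> l <= D%:R.
Proof.
move=> D0 diam xyl; have D1 : 1 <= D%:R :> R by rewrite ler1n.
have : (gdist x y < +oo)%E by rewrite xyl ltry.
move=> /ereal_inf_lt[_ [k + _] _].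
case=> [[u [v [xuv yuv _]]]|[a [c [n [xa yc ac _]]]]].
  have := gdist_edge xuv yuv; rewrite xyl lee_fin => /le_trans; apply.
  apply: le_trans D1; case: xuv yuv => _ xu xv xx _ [_ yu yv yy _].
  by rewrite ler_distl; apply/andP; split; lra.
have [b xab] := coord_edge_at xa; have [d ycd] := coord_edge_at yc.
have [ab _ _ xx _] := xab; have [cd _ _ yy _] := ycd.
have ba := walk1 (adj_sym ab); have cd1 := walk1 cd.
have ad := walk_cat ac cd1; have bc := walk_cat ba ac; have bd := walk_cat ba ad.
have [side sideP] := bip.
(* The sides of the ends fix the parity, so shortening a walk preserves it. *)
have short (u v : H) j : walk j u v ->
    exists m, [/\ (m <= D)%N, odd m = odd j & walk m u v].
  move=> uv; have [|m mD uvm] := diam u v; first by exists j.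
  by exists m; rewrite (walk_parity sideP uv) (walk_parity sideP uvm).
have [m1 [m1D m1o {}ac]] := short _ _ _ ac; have [m2 [m2D m2o {}ad]] := short _ _ _ ad.
have [m3 [m3D m3o {}bc]] := short _ _ _ bc; have [m4 [m4D m4o {}bd]] := short _ _ _ bd.
have := gdist_walk xab ycd ac; have := gdist_walk xab (on_edge_sym ycd) ad.
have := gdist_walk (on_edge_sym xab) ycd bc.
have := gdist_walk (on_edge_sym xab) (on_edge_sym ycd) bd.
rewrite xyl !lee_fin => lbd lbc lad lac.
have : (m1 + m4 + 2 <= D + D)%N \/ (m2 + m3 + 2 <= D + D)%N by lia.
by case; rewrite -(ler_nat R) !natrD; lra.
Qed.

End BipartiteDiameter.

(** * Bounds for the direct product *)

Section DirectProductTheory.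
Variables (R : realType) (G1 G2 : sgraph).
Hypotheses (conn1 : connected_graph G1) (conn2 : connected_graph G2).
Hypotheses (bip1 : bipartite G1) (bip2 : bipartite G2).
Hypothesis nbr1 : forall w : G1, exists z, adj w z.
Hypothesis nbr2 : forall w : G2, exists z, adj w z.
Let P := dprod G1 G2.

Lemma dprod_nbr (w : P) : exists z, adj w z.
Proof.
have [z1 h1] := nbr1 w.1; have [z2 h2] := nbr2 w.2.
by exists (z1, z2).
Qed.

Lemma dprod_bipartite : bipartite P.
Proof. by have [side sideP] := bip1; exists (fun p => side p.1) => u v [/sideP]. Qed.

Lemma dprod_walk n (p q : P) : walk n p.1 q.1 -> walk n p.2 q.2 -> walk n p q.
Proof.
elim: n p => [|n IH] [p1 p2] /=; first by case: q => q1 q2 /= -> ->.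
by move=> [z1 [a1 h1]] [z2 [a2 h2]]; exists (z1, z2); split=> //; exact: IH.
Qed.

Lemma dprod_diam D : (forall u v : G1, (vdist u v <= D)%N) ->
  (forall u v : G2, (vdist u v <= D)%N) ->
  forall p q : P, reachable p q -> exists2 n, (n <= D)%N & walk n p q.
Proof.
move=> D1 D2 p q [N pq].
have [side1 s1] := bip1; have [side2 s2] := bip2.
have w1 := walk_vdist (conn1.2 p.1 q.1); have w2 := walk_vdist (conn2.2 p.2 q.2).
have N1 : walk N p.1 q.1 by apply: (walk_hom (G1 := P) (h := fst)) pq => u v [].
have N2 : walk N p.2 q.2 by apply: (walk_hom (G1 := P) (h := snd)) pq => u v [].
have o1 : odd (vdist p.1 q.1) = odd N by rewrite (walk_parity s1 w1) (walk_parity s1 N1).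
have o2 : odd (vdist p.2 q.2) = odd N by rewrite (walk_parity s2 w2) (walk_parity s2 N2).
(* Both projected distances have the parity of [N], so the shorter walk can be padded to the length
   of the longer one; truncated subtraction leaves the longer one unpadded. *)
exists (maxn (vdist p.1 q.1) (vdist p.2 q.2)); first by rewrite geq_max D1 D2.
set m1 := vdist _ _ in w1 o1 *; set m2 := vdist _ _ in w2 o2 *.
have [z1 a1] := nbr1 p.1; have [z2 a2] := nbr2 p.2.
apply: dprod_walk.
- rewrite (_ : maxn _ _ = m1 + (m2 - m1)./2.*2)%N; first exact: walk_pad a1 w1.
  by lia.
- rewrite (_ : maxn _ _ = m2 + (m1 - m2)./2.*2)%N; first exact: walk_pad a2 w2.
  by lia.
Qed.

Lemma delta_dprod_le (D : nat) : (0 < D)%N ->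
  (forall u v : G1, (vdist u v <= D)%N) -> (forall u v : G2, (vdist u v <= D)%N) ->
  (delta R P <= (D%:R / 2)%:E)%E.
Proof.
move=> D0 D1 D2; apply: ge_ereal_sup => _ [u ->].
apply: hyperbolicity_le => [|x y l]; first exact: ler0n.
exact: (bipartite_gdist_le dprod_bipartite dprod_nbr D0 (dprod_diam D1 D2)).
Qed.

Lemma delta_dprodl : (delta R G1 <= delta R P)%E.
Proof.
have [side sideP] := bip1; have [b] := conn2.1; have [c bc] := nbr2 b.
apply: (@delta_retract _ _ _ (fun u => (u, if side u then b else c) : P) fst) => //.
  move=> u v uv; split=> //=.
  by case: (side u) (side v) (sideP _ _ uv) => [] [] //= _; exact: adj_sym.
by move=> u v [].
Qed.

Lemma delta_dprodr : (delta R G2 <= delta R P)%E.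
Proof.
have [side sideP] := bip2; have [b] := conn1.1; have [c bc] := nbr1 b.
apply: (@delta_retract _ _ _ (fun u => (if side u then b else c, u) : P) snd) => //.
  move=> u v uv; split=> //=.
  by case: (side u) (side v) (sideP _ _ uv) => [] [] //= _; exact: adj_sym.
by move=> u v [].
Qed.

(* Two geodesics from [(p 0, q m)] to [(p (2 * m), q m)]: one climbs to [q 0] at
   its midpoint, the other one alternates between [q m] and [q (m + 1)]. *)
Lemma delta_dprod_ge m : (exists u v : G1, vdist u v = 2 * m)%N ->
  (exists u v : G2, vdist u v = m.+1) -> (m%:R%:E <= delta R P)%E.
Proof.
move=> [u [u' uu']] [v [v' vv']].
have [p [pS pd]] := geodesic_path conn1 nbr1 uu'.
have [q [qS qd]] := geodesic_path conn2 nbr2 vv'.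
(* With truncated subtraction, the index of [q] is the absolute value of [i - m]. *)
pose A i : P := (p i, q ((m - i) + (i - m))%N).
pose C i : P := (p i, q (m + odd i)%N).
have AS i : adj (A i) (A i.+1).
  split=> //=; have [im|mi] := ltnP i m.
    rewrite (_ : m - i + (i - m) = (m - i.+1 + (i.+1 - m)).+1)%N; last by lia.
    exact: adj_sym.
  by rewrite (_ : m - i.+1 + (i.+1 - m) = (m - i + (i - m)).+1)%N; last by lia.
have CS i : adj (C i) (C i.+1).
  split=> //=; case: (odd i) => /=; rewrite addn0 addn1 //.
  exact: adj_sym.
(* [f1] certifies that both curves are geodesics; [f2] separates the midpoint of [A], where it is 0,
   from [C], where it is at least [m]. *)
pose f1 (z : P) : R := (vdist (p 0%N) z.1)%:R.
pose f2 (z : P) : R := (vdist (q 0%N) z.2)%:R.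
have f1lip : lipschitz1 f1 by move=> y z [yz _]; exact: vdist_lipschitz yz.
have f2lip : lipschitz1 f2 by move=> y z [_ yz]; exact: vdist_lipschitz yz.
have f1A i : (i <= 2 * m)%N -> f1 (A i) = i%:R by move=> im; rewrite /f1 pd.
have f1C i : (i <= 2 * m)%N -> f1 (C i) = i%:R by move=> im; rewrite /f1 pd.
have f2A : f2 (A m) = 0 by rewrite /f2 /= subnn vdistxx.
have f2C i : m%:R <= f2 (C i) by rewrite /f2 /= qd ?ler_nat; case: (odd i); lia.
have [SA [gA SAm SAe]] := polyline_geodesic AS f1lip f1A.
have [SC [gC _ SCe]] := polyline_geodesic CS f1lip f1C.
have C0 : C 0%N = A 0%N by rewrite /A /C; congr (_, q _) => /=; lia.
have Cn : C (2 * m)%N = A (2 * m)%N.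
  by rewrite /A /C; congr (_, q _); rewrite oddM /=; lia.
rewrite C0 Cn in gC.
have gB : geodesic (@gdist R P) (vpoint R (A (2 * m)%N)) (vpoint R (A (2 * m)%N))
    [set vpoint R (A (2 * m)%N)].
  apply: geodesic_refl; apply/le_anti; rewrite gdist_ge0 andbT.
  apply: le_trans (gdist_edge (vpoint_on_edge _ (AS _)) (vpoint_on_edge _ (AS _))) _.
  by rewrite subrr normr0.
have AY : SA `<=` gcomponent (A 0%N).
  by move=> x /SAe[i xi]; exact: path_component xi.
have CY : SC `<=` gcomponent (A 0%N).
  by move=> x /SCe[i xi]; rewrite -C0; exact: path_component xi.
apply: (@le_trans _ _ (hyperbolicity (@gdist R P) (gcomponent (A 0%N)))); last first.
  by apply: ereal_sup_ubound; exists (A 0%N).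
apply: (@le_trans _ _ (thinness (@gdist R P) SA [set vpoint R (A (2 * m)%N)] SC)); last first.
  apply: ereal_sup_ubound; exists SA, [set vpoint R (A (2 * m)%N)], SC; split=> //.
    exists (vpoint R (A 0%N)), (vpoint R (A (2 * m)%N)), (vpoint R (A (2 * m)%N)).
    by split=> //; exact: geodesic_sym.
  by move=> _ ->; exact/AY/SAm.
apply: le_ereal_inf_tmp => _ [e [e0 [hA _ _]] <-].
have [|z zBC] := hA (vpoint R (A m)); first by apply: SAm; lia.
move=> pz; apply: le_trans pz; apply: le_trans (bary_gdist _ _ f2lip).
(* The degenerate side is an end of [SC], so [z] is on [SC] in either case. *)
have /SCe[i zi] : SC z by case: zBC => // ->; exact: geodesic_right gC.
rewrite lee_fin bary_vpoint f2A sub0r normrN (bary_edge f2 zi).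
case: zi => _ zi zi1 zz _; apply: le_trans (ler_norm _).
(* The value at [z] is a convex combination of two values of [f2] that are at least [m]. *)
rewrite -[leLHS]mul1r -{1}zz mulrDl.
by apply: lerD; apply: ler_wpM2l.
Qed.

End DirectProductTheory.

(** * Conclusion, by cases on the finiteness of the two diameters *)

Local Open Scope ereal_scope.

Theorem theorem3p6 (R : realType) (G1 G2 : sgraph)
    (conn1 : connected_graph G1) (conn2 : connected_graph G2)
    (bip1 : bipartite G1) (bip2 : bipartite G2)
    (k1 k2 : \bar R)
    (k1E : k1 = diamV R G1) (k2E : k2 = diamV R G2)
    (k2_le_k1 : k2 <= k1) (k2_ge1 : 1 <= k2) :
  [/\ maxe (mine ((k1 - 1) * (2^-1)%:E) (k2 - 1))
           (maxe (delta R G1) (delta R G2))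
        <= delta R (dprod G1 G2),
      delta R (dprod G1 G2) <= k1 * (2^-1)%:E
    & k1 <= 2%:E * k2 - 2%:E ->
      (exists n : nat, k1 = ((2 * n)%:R)%:E) ->
      delta R (dprod G1 G2) = k1 * (2^-1)%:E].
Proof.
have nbr (G : sgraph) : connected_graph G -> 1 <= diamV R G ->
    forall w : G, exists z, adj w z.
  move=> conn ge1; have [u [v uv]] : exists u v : G, vdist u v = 1%N.
    have [[_ onto]|[D [DE _ onto]]] := diamV_cases R conn; first exact: onto.
    by apply: onto; move: ge1; rewrite DE lee_fin ler1n.
  move=> w; apply: (connected_adj w conn (u := u) (v := v)) => E.
  by rewrite E vdistxx in uv.
have nbr1 : forall w : G1, exists z, adj w z.
  by apply: nbr => //; rewrite -k1E; exact: le_trans k2_le_k1.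
have nbr2 : forall w : G2, exists z, adj w z by apply: nbr; rewrite -?k2E.
have lower := delta_dprod_ge R conn1 conn2 nbr1 nbr2.
have upper := delta_dprod_le R conn1 conn2 bip1 bip2 nbr1 nbr2.
have deltas : maxe (delta R G1) (delta R G2) <= delta R (dprod G1 G2).
  by rewrite ge_max delta_dprodl ?delta_dprodr.
have halfy : +oo * (2^-1)%:E = +oo :> \bar R by rewrite gt0_mulye// lte_fin invr_gt0.
have [[k1y dist1]|[D1 [k1D dist1 onto1]]] := diamV_cases R conn1;
    have [[k2y dist2]|[D2 [k2D dist2 onto2]]] := diamV_cases R conn2.
- have deltay : delta R (dprod G1 G2) = +oo.
    apply: eq_infty => r; apply: le_trans (lower (Num.truncn r).+1 _ _) => //.
    by rewrite lee_fin ltW// truncnS_gt.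
  by rewrite k1E k1y deltay !leey halfy; split.
- rewrite k1E k1y halfy leey; split=> //; last by move=> _ [].
  rewrite ge_max deltas andbT ge_min; apply/orP; right.
  move: k2_ge1; rewrite k2E k2D lee_fin ler1n => D2gt0.
  (* All distances occur in [G1], so only [m + 1 <= D2] limits [m]: take [m = D2 - 1]. *)
  rewrite -EFinB -{1}(prednK D2gt0) -natr1 addrK; apply: lower => //; apply: onto2; lia.
- by move: k2_le_k1; rewrite k1E k2E k1D k2y.
- move: k2_ge1 k2_le_k1; rewrite k1E k2E k1D k2D !lee_fin ler1n ler_nat => D2gt0 D21.
  have {}upper : delta R (dprod G1 G2) <= (D1%:R / 2)%:E.
    apply: upper => //; first exact: leq_trans D21.
    by move=> u v; apply: leq_trans D21.
  have {}lower m : (2 * m <= D1)%N -> (m.+1 <= D2)%N ->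
      m%:R%:E <= delta R (dprod G1 G2).
    by move=> /onto1 h1 /onto2 h2; exact: lower.
  split=> //.
  + rewrite ge_max deltas andbT ge_min; apply/orP.
    (* Take for [m] the smaller of [D1./2] and [D2 - 1]; rounding [D1 / 2] down loses at most 1/2,
       whence [(k1 - 1) / 2]. *)
    have [h|h] := leqP (D1./2) D2.-1; [left|right].
      have {}lower : (D1./2)%:R%:E <= delta R (dprod G1 G2) by apply: lower; lia.
      apply: le_trans lower.
      rewrite -EFinB -EFinM lee_fin.
      have : (D1 <= D1./2 + D1./2 + 1)%N by lia.
      by rewrite -(ler_nat R) !natrD; lra.
    by rewrite -EFinB -{1}(prednK D2gt0) -natr1 addrK; apply: lower; lia.
  + rewrite -EFinM => h [n [D1n]].
    move/eqP: D1n; rewrite eqr_nat => /eqP D1n.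
    apply/le_anti; rewrite upper /= D1n natrM mulrC mulKf//.
    (* Here [m = n] is exactly half of [D1], and [k1 <= 2 * k2 - 2] says that [n + 1 <= D2]. *)
    apply: lower; first by rewrite D1n.
    by rewrite -(ler_nat R) -natr1; rewrite D1n natrM in h; lra.
Qed.
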